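(* Let $f=\bar\ell:\mathbb{R}^K\to\mathbb{R}$ be the multinomial logistic loss associated with a choice vector $(y_0,y_1,\dots,y_K)\in\{0,1\}^{K+1}$, $\sum_{i=0}^Ky_i=1$. Then for all $\mathbf{x},\mathbf{u}_1,\mathbf{u}_2\in\mathbb{R}^K$, $$\left|D^3f(\mathbf{x})[\mathbf{u}_1,\mathbf{u}_2,\mathbf{u}_2]\right|\le3\sqrt2\,\|\mathbf{u}_1\|_\infty\,\|\mathbf{u}_2\|^2_{\nabla^2f(\mathbf{x})}.$$
   Context: The multinomial logistic loss with outside option $0$ is $\bar\ell(\mathbf{z})=-\sum_{i=0}^{K}y_i\log\left(\frac{\exp(z_i)}{1+\sum_{j=1}^K\exp(z_j)}\right)$ for $\mathbf{z}=(z_1,\dots,z_K)\in\mathbb{R}^K$, with the convention $z_0=0$. $D^3f(\mathbf{x})[\mathbf{u},\mathbf{v},\mathbf{w}]$ is the third derivative of $f$ at $\mathbf{x}$ as a symmetric trilinear form, and $\|\mathbf{u}\|_A^2=\mathbf{u}^\top A\mathbf{u}$. *)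

(* Defs.v *)
From HB Require Import structures.
From mathcomp Require Import all_boot all_order all_algebra.
From mathcomp Require Import all_classical all_reals all_analysis.
Import Order.TTheory GRing.Theory Num.Theory.
Import numFieldNormedType.Exports.

Set Implicit Arguments.
Unset Strict Implicit.
Unset Printing Implicit Defensive.

Local Open Scope ring_scope.

(* Index [ord0 : 'I_K.+1] is the outside option, of utility 0; index
   [lift ord0 j] is the alternative whose utility is the coordinate [z j 0]. *)
Definition utility (R : realType) (K : nat) (z : 'cV[R]_K) (i : 'I_K.+1) : R :=
  if unlift ord0 i is Some j then z j 0 else 0.

Definition mnl_loss (R : realType) (K : nat) (y : 'I_K.+1 -> R)
    (z : 'cV[R]_K) : R :=
  - \sum_(i < K.+1)
      y i * ln (expR (utility z i) / (1 + \sum_(j < K) expR (z j 0))).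

(* Higher Frechet derivatives, with operator-valued derivatives read curried:
   the derivative of y |-> D^2 f(y) at x along u, evaluated at (v, w), is the
   derivative of y |-> D^2 f(y)[v, w] at x along u. *)
Definition D2 (R : realType) (V : normedModType R) (f : V -> R)
    (x u v : V) : R :=
  'd (fun y => 'd f y v) x u.

Definition D3 (R : realType) (V : normedModType R) (f : V -> R)
    (x u v w : V) : R :=
  'd (fun y => D2 f y v w) x u.

Definition hessian (R : realType) (K : nat) (f : 'cV[R]_K -> R)
    (x : 'cV[R]_K) : 'M[R]_K :=
  \matrix_(i, j) D2 f x (delta_mx i 0) (delta_mx j 0).

(* The square of the seminorm induced by A. *)
Definition sqnorm_mx (R : realType) (K : nat) (A : 'M[R]_K)
    (u : 'cV[R]_K) : R :=
  (u^T *m A *m u) 0 0.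

(* Main.v *)
(** Up to a linear term the loss is the log-partition function of the softmax
    distribution on the K + 1 alternatives, so its second and third derivatives
    are the covariance and the third joint central moment of the utilities
    under that distribution.  The centred first utility is at most
    [2 * `|u1|] in absolute value, and pulling this bound out of the third
    moment leaves the variance of the second utility, which is the squared
    Hessian norm.  This yields the constant 2, smaller than 3 sqrt 2. *)
Require Import Defs.
From HB Require Import structures.
From mathcomp Require Import all_boot all_order all_algebra.
From mathcomp Require Import all_classical all_reals all_analysis.
From mathcomp Require Import ring lra.
Import Order.TTheory GRing.Theory Num.Theory.
Import numFieldNormedType.Exports.

Local Open Scope ring_scope.

(** * Differentials of sums, compositions and quotients *)

Section DifferentialCalculus.
Context {R : realType} {V : normedModType R}.
Implicit Types (f df : V -> R) (x : V).

Lemma is_diff_sum_fun (n : nat) (F dF : 'I_n -> V -> R) x :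
  (forall i, is_diff x (F i) (dF i)) ->
  is_diff x (fun z => \sum_(i < n) F i z) (fun u => \sum_(i < n) dF i u).
Proof.
move=> dFx.
have -> : (fun z => \sum_(i < n) F i z) = \sum_(i < n) F i.
  by apply/funext => z; rewrite fct_sumE.
have -> : (fun u => \sum_(i < n) dF i u) = \sum_(i < n) dF i.
  by apply/funext => u; rewrite fct_sumE.
by elim/big_rec2: _ => [|i g dg _ dgx]; [exact: is_diff_cst|exact: is_diffD].
Qed.

Lemma is_diff_comp_derive1 {f df x} {g : R -> R} {g' : R} :
  is_diff x f df -> is_derive (f x) 1 g g' ->
  is_diff x (fun z => g (f z)) (fun u => g' * df u).
Proof.
move=> dfx gx.
have /derivable1_diffP dg : derivable g (f x) 1 by exact: ex_derive.
have gd : is_diff (f x) g (fun h => g' * h).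
  apply: DiffDef => //; rewrite diff1E //; apply/funext => h.
  by rewrite derive1E derive_val mulrC.
exact: (is_diff_comp dfx gd).
Qed.

(** The differential is arranged around the ratio [f x / g x], so that for a ratio of weighted sums
    it reads as a mean of products minus a product of means. *)
Lemma is_diff_div {f df g dg : V -> R} {x} :
  is_diff x f df -> is_diff x g dg -> g x != 0 ->
  is_diff x (fun z => f z / g z)
    (fun u => df u / g x - f x / g x * (dg u / g x)).
Proof.
move=> dfx dgx gx0.
have dVx : is_diff x (fun z => (g z)^-1) (fun u => - (g x) ^- 2 * dg u).
  apply: DiffDef; first exact: differentiableV.
  by rewrite diffV //; apply/funext => u /=; rewrite diff_val.
have quotE (a b c d : R) : b != 0 ->
    a * (- b ^- 2 * d) + b^-1 * c = c / b - a / b * (d / b).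
  by move=> b0; field.
apply: (is_diff_eq (is_diffM dfx dVx)); apply/funext => u.
exact: quotE.
Qed.

End DifferentialCalculus.

(** * Moments of the softmax distribution and their derivatives *)

Section Softmax.
Context {R : realType} {K : nat}.
Implicit Types (x z u v : 'cV[R]_K) (h : 'I_K.+1 -> R).

(** Unnormalised expectation; at [h = 1] it is the partition function. *)
Definition wsum h z : R := \sum_(i < K.+1) expR (utility z i) * h i.

Definition softmean h z : R := wsum h z / wsum (fun=> 1) z.

Lemma wsum1_gt0 z : 0 < wsum (fun=> 1) z.
Proof.
rewrite /wsum big_ord_recl ltr_wpDr ?mulr1 ?expR_gt0 //.
by apply: sumr_ge0 => i _; rewrite mulr1 expR_ge0.
Qed.

Lemma wsum1E z : wsum (fun=> 1) z = 1 + \sum_(j < K) expR (z j 0).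
Proof.
rewrite /wsum big_ord_recl /utility unlift_none expR0 mulr1; congr (_ + _).
by apply: eq_bigr => j _; rewrite liftK mulr1.
Qed.

Lemma is_diff_utility x i :
  is_diff x (fun z => utility z i) (fun u => utility u i).
Proof.
rewrite /utility; case: (unlift ord0 i) => [j|]; last exact: is_diff_cst.
have lin : linear (fun z : 'cV[R]_K => z j 0 : R) by move=> a u v; rewrite !mxE.
pose lM := GRing.isLinear.Build _ _ _ _ _ lin.
(* The coordinate map is packed as a linear map so that [diff_lin] makes it its own differential. *)
pose L : {linear 'cV[R]_K -> R} := HB.pack (fun z : 'cV[R]_K => z j 0 : R) lM.
apply: DiffDef; first exact: differentiable_coord.
by rewrite (@diff_lin _ _ _ L) //; exact: coord_continuous.
Qed.

Lemma is_diff_wsum h x :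
  is_diff x (wsum h) (fun u => wsum (fun i => h i * utility u i) x).
Proof.
apply: is_diff_sum_fun => i.
have := is_diff_comp_derive1 (is_diff_utility x i) (is_derive_expR _).
move=> /(is_diffZ (h i)) dh.
have eZ : h i *: (fun z => expR (utility z i)) =
    (fun z => expR (utility z i) * h i).
  by apply/funext => z; rewrite mulrC.
rewrite eZ in dh.
by apply: (is_diff_eq dh); apply/funext => u; exact: mulrCA.
Qed.

(** The derivative of an expectation along [u] is the covariance of [h] with the utility of [u];
    iterating this rule produces the higher derivatives of the loss. *)
Lemma is_diff_softmean h x :
  is_diff x (softmean h) (fun u => softmean (fun i => h i * utility u i) x
                        - softmean h x * softmean (utility u) x).
Proof.
have dd := is_diff_div (is_diff_wsum h x) (is_diff_wsum (fun=> 1) x)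
  (lt0r_neq0 (wsum1_gt0 x)).
apply: (is_diff_eq dd); apply/funext => u; congr (_ - _ * (_ / _)).
by apply: eq_bigr => i _; rewrite mul1r.
Qed.

Lemma softmeanD h1 h2 x :
  softmean (fun i => h1 i + h2 i) x = softmean h1 x + softmean h2 x.
Proof.
rewrite /softmean -mulrDl; congr (_ / _); rewrite /wsum -big_split.
by apply: eq_bigr => i _; rewrite mulrDr.
Qed.

Lemma softmeanZ (c : R) h x :
  softmean (fun i => c * h i) x = c * softmean h x.
Proof.
rewrite /softmean mulrA /wsum big_distrr /=; congr (_ / _).
by apply: eq_bigr => i _; rewrite mulrCA.
Qed.

Lemma softmean_cst (c : R) x : softmean (fun=> c) x = c.
Proof.
have -> : (fun _ : 'I_K.+1 => c) = (fun=> c * 1) by rewrite mulr1.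
by rewrite softmeanZ /softmean divff ?mulr1 // lt0r_neq0 ?wsum1_gt0.
Qed.

Lemma le_softmean h1 h2 x :
  (forall i, h1 i <= h2 i) -> softmean h1 x <= softmean h2 x.
Proof.
move=> h12; rewrite ler_wpM2r ?invr_ge0 ?(ltW (wsum1_gt0 x)) //.
by apply: ler_sum => i _; rewrite ler_wpM2l ?expR_ge0.
Qed.

Lemma ler_norm_softmean h x : `|softmean h x| <= softmean (fun i => `|h i|) x.
Proof.
rewrite ler_norml -mulN1r -softmeanZ; apply/andP; split; apply: le_softmean => i.
  by rewrite mulN1r lerNl -normrN ler_norm.
exact: ler_norm.
Qed.

Lemma utility_le_norm u i : `|utility u i| <= `|u|.
Proof.
rewrite /utility; case: (unlift ord0 i) => [j|]; last by rewrite normr0.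
rewrite [leRHS]mx_normrE.
exact: (le_bigmax _ (fun ij : 'I_K * 'I_1 => `|u ij.1 ij.2|) (j, 0)).
Qed.

Definition softcov u v x : R :=
  softmean (fun i => utility u i * utility v i) x
  - softmean (utility u) x * softmean (utility v) x.

Lemma softvarE u x : softcov u u x =
  softmean (fun i => (utility u i - softmean (utility u) x) ^+ 2) x.
Proof.
set m := softmean (utility u) x.
have -> : (fun i => (utility u i - m) ^+ 2) = (fun i =>
    utility u i * utility u i + ((- 2 * m) * utility u i + m ^+ 2)).
  by apply/funext => i; ring.
rewrite !softmeanD softmeanZ softmean_cst /softcov -/m; ring.
Qed.

(** The right-hand side has the shape that the product rule gives when a covariance of [h2] and [h3]
    is differentiated in a direction of utility [h1]. *)
Lemma softmean_central3 (h1 h2 h3 : 'I_K.+1 -> R) x :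
  softmean (fun i => (h1 i - softmean h1 x) * (h2 i - softmean h2 x)
    * (h3 i - softmean h3 x)) x =
  softmean (fun i => h2 i * h3 i * h1 i) x
    - softmean (fun i => h2 i * h3 i) x * softmean h1 x
  - (softmean h2 x
       * (softmean (fun i => h3 i * h1 i) x - softmean h3 x * softmean h1 x)
     + softmean h3 x
       * (softmean (fun i => h2 i * h1 i) x - softmean h2 x * softmean h1 x)).
Proof.
set a := softmean h1 x; set b := softmean h2 x; set c := softmean h3 x.
(* Constants stand on the left and sums nest to the right, so that linearity of the mean applies
   term by term. *)
have -> : (fun i => (h1 i - a) * (h2 i - b) * (h3 i - c)) = (fun i =>
    h2 i * h3 i * h1 i + (- a * (h2 i * h3 i) + (- c * (h2 i * h1 i)
    + (- b * (h3 i * h1 i) + (b * c * h1 i + (a * c * h2 i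
    + (a * b * h3 i + - (a * b * c)))))))).
  by apply/funext => i; ring.
rewrite !softmeanD !softmeanZ softmean_cst -/a -/b -/c; ring.
Qed.

Lemma is_diff_softcov u v x :
  is_diff x (softcov u v) (fun w =>
    softmean (fun i => (utility w i - softmean (utility w) x)
      * (utility u i - softmean (utility u) x)
      * (utility v i - softmean (utility v) x)) x).
Proof.
have dd := is_diffB (is_diff_softmean (fun i => utility u i * utility v i) x)
  (is_diffM (is_diff_softmean (utility u) x) (is_diff_softmean (utility v) x)).
apply: (is_diff_eq dd); apply/funext => w.
by rewrite softmean_central3.
Qed.

End Softmax.

Lemma linear_cV_sum {R : pzRingType} {K : nat} (L : {linear 'cV[R]_K -> R^o}) u :
  L u = \sum_j u j 0 * L (delta_mx j 0).
Proof.
rewrite {1}[u]matrix_sum_delta linear_sum; apply: eq_bigr => j _.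
by rewrite big_ord1 linearZ.
Qed.

(** * Derivatives of the loss as softmax moments *)

Section MnlLoss.
Context {R : realType} {K : nat} (y : 'I_K.+1 -> R).
Context (ysum : \sum_(i < K.+1) y i = 1).
Implicit Types x u v w : 'cV[R]_K.

(** Each log-probability is a utility minus the log-partition function, which gets total weight 1
    because the [y i] sum to 1. *)
Lemma mnl_lossE :
  mnl_loss y = fun z => ln (wsum (fun=> 1) z) - \sum_(i < K.+1) y i * utility z i.
Proof.
apply/funext => z; rewrite /mnl_loss -wsum1E.
under eq_bigr do
  rewrite ln_div ?posrE ?expR_gt0 ?wsum1_gt0 // expRK mulrBr.
by rewrite big_split /= sumrN -big_distrl /= ysum mul1r opprD opprK addrC.
Qed.

Lemma diff_mnl_loss x v :
  'd (mnl_loss y) x v = softmean (utility v) x - \sum_(i < K.+1) y i * utility v i.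
Proof.
have dln := is_diff_comp_derive1 (is_diff_wsum (fun=> 1) x)
  (is_derive1_ln (wsum1_gt0 x)).
have dlin : is_diff x (fun z => \sum_(i < K.+1) y i * utility z i)
    (fun u => \sum_(i < K.+1) y i * utility u i).
  by apply: is_diff_sum_fun => i; exact: is_diffZ (is_diff_utility x i).
have dl := is_diffB dln dlin.
rewrite mnl_lossE (@diff_val _ _ _ _ _ _ _ dl) [LHS]/(_ * _ - _) mulrC /=.
by congr (_ / _ - _); apply: eq_bigr => i _; rewrite mul1r.
Qed.

Lemma D2_mnl_loss x u v : D2 (mnl_loss y) x u v = softcov v u x.
Proof.
rewrite /D2 (_ : (fun z => _) = softmean (utility v)
   - cst (\sum_(i < K.+1) y i * utility v i)); last first.
  by apply/funext => z; rewrite diff_mnl_loss.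
have dm := is_diffB (is_diff_softmean (utility v) x)
  (is_diff_cst (\sum_(i < K.+1) y i * utility v i) x).
by rewrite (@diff_val _ _ _ _ _ _ _ dm) subr0.
Qed.

Lemma D3_mnl_loss x u v w :
  D3 (mnl_loss y) x u v w =
  softmean (fun i => (utility u i - softmean (utility u) x)
      * (utility w i - softmean (utility w) x)
      * (utility v i - softmean (utility v) x)) x.
Proof.
rewrite /D3 (_ : (fun z => _) = softcov w v).
  by rewrite (@diff_val _ _ _ _ _ _ _ (is_diff_softcov w v x)).
by apply/funext => z; rewrite D2_mnl_loss.
Qed.

Lemma sqnorm_hessian_mnl_loss x u :
  sqnorm_mx (hessian (mnl_loss y) x) u = softcov u u x.
Proof.
(* Linearity in the first direction holds because [D2] is a differential there; symmetry, read off
   the covariance, carries it to the second. *)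
have D2l v w : D2 (mnl_loss y) x v w =
    \sum_j v j 0 * D2 (mnl_loss y) x (delta_mx j 0) w.
  exact: linear_cV_sum.
have D2C v w : D2 (mnl_loss y) x v w = D2 (mnl_loss y) x w v.
  by rewrite !D2_mnl_loss /softcov mulrC; under eq_fun do rewrite mulrC.
rewrite -D2_mnl_loss D2l /sqnorm_mx -mulmxA mxE; apply: eq_bigr => i _.
rewrite !mxE D2C D2l; congr (_ * _); apply: eq_bigr => j _.
by rewrite !mxE mulrC D2C.
Qed.

End MnlLoss.

(* `|u1| is the library norm on matrices, that is the max norm. *)
Theorem propositionB4 (R : realType) (K : nat) (y : 'I_K.+1 -> R)
    (y01 : forall i, y i = 0 \/ y i = 1)
    (ysum : \sum_(i < K.+1) y i = 1)
    (x u1 u2 : 'cV[R]_K) :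
  `|D3 (mnl_loss y) x u1 u2 u2|
    <= 3 * Num.sqrt 2 * `|u1| * sqnorm_mx (hessian (mnl_loss y) x) u2.
Proof.
(* Once the constant is inside the mean, both sides are means under the same distribution, and a
   comparison at each alternative [i] suffices. *)
rewrite D3_mnl_loss // sqnorm_hessian_mnl_loss // softvarE -softmeanZ.
apply: le_trans (ler_norm_softmean _ _) _; apply: le_softmean => i.
rewrite -mulrA normrM -expr2 [`|_ ^+ 2|]ger0_norm ?sqr_ge0 //.
rewrite ler_wpM2r ?sqr_ge0 //.
have norm_mean : `|softmean (utility u1) x| <= `|u1|.
  rewrite -[leRHS](softmean_cst _ x); apply: le_trans (ler_norm_softmean _ _) _.
  by apply: le_softmean => j; exact: utility_le_norm.
(* One [|u1|] bounds the utility, the other its mean. *)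
apply: (@le_trans _ _ (2 * `|u1|)).
  apply: le_trans (ler_normB _ _) _.
  by rewrite mulr_natl mulr2n lerD ?utility_le_norm.
rewrite ler_wpM2r //.
have : (1 : R) <= Num.sqrt 2 by rewrite -[leLHS]sqrtr1 ler_sqrt ?ler1n.
lra.
Qed.
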